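(* Let $L$ be a set with non-empty families $O_A,O_B$ of binary operations such that for all $*_\alpha\in O_A$, $*_\beta\in O_B$ and all $x,y,z\in L$ $$x*_\alpha(y*_\beta z)=(x*_\alpha y)*_\beta(x*_\alpha z),\qquad x*_\beta(y*_\alpha z)=(x*_\beta y)*_\alpha(x*_\beta z).$$ Let $s_1,\ldots,s_m,t_1,\ldots,t_n\in L$, $S_A=\langle s_1,\ldots,s_m\rangle_{O_A}$, $S_B=\langle t_1,\ldots,t_n\rangle_{O_B}$. Let $k_A,k_B\ge 1$, $a_0\in S_A$, $(a_1,\ldots,a_{k_A})\in L^{k_A}$, $( *_{A_1},\ldots,*_{A_{k_A}})\in O_A^{k_A}$, $(b_1,\ldots,b_{k_B})\in S_B^{k_B}$, $( *_{B_1},\ldots,*_{B_{k_B}})\in O_B^{k_B}$, and put, for $y\in L$, $$\alpha(y)=a_{k_A}*_{A_{k_A}}(a_{k_A-1}*_{A_{k_A-1}}\cdots *_{A_3}(a_2*_{A_2}(a_1*_{A_1}y))\cdots),$$ $$\beta(y)=b_{k_B}*_{B_{k_B}}(b_{k_B-1}*_{B_{k_B-1}}\cdots *_{B_3}(b_2*_{B_2}(b_1*_{B_1}y))\cdots),$$ and $p_0=\alpha(a_0)$. Suppose $a_0=T_{O_A}(r_1,\ldots,r_l)$ with all $r_i\in\{s_1,\ldots,s_m\}$ and, for each $1\le j\le k_B$, $b_j=T^{(j)}_{O_B}(u_{j,1},\ldots,u_{j,l_j})$ with all $u_{j,i}\in\{t_1,\ldots,t_n\}$. Then $$T_{O_A}(\beta(r_1),\ldots,\beta(r_l))=\beta(a_0),\qquad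 T^{(j)}_{O_B}(\alpha(u_{j,1}),\ldots,\alpha(u_{j,l_j}))=\alpha(b_j)\quad(1\le j\le k_B),$$ and the key $K_A:=\alpha(\beta(a_0))$ computed by Alice equals the key computed by Bob, $$K_B:=\alpha(b_{k_B})*_{B_{k_B}}(\alpha(b_{k_B-1})*_{B_{k_B-1}}(\cdots(\alpha(b_2)*_{B_2}(\alpha(b_1)*_{B_1}p_0))\cdots)).$$
   Context: For a family $O$ of binary operations on $L$, $T_O(y_1,\ldots,y_k)$ denotes the element obtained from a planar rooted binary tree $T$ with $k$ leaves, whose leaves are labelled from left to right by $y_1,\ldots,y_k\in L$ and each of whose internal vertices is labelled by an operation in $O$, by evaluating each internal vertex with its operation; the labelling of internal vertices is part of the data of $T_O$. The submagma $\langle y_1,\ldots,y_k\rangle_O$ is the set of all such elements with leaves in $\{y_1,\ldots,y_k\}$. *)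

(* Defs.v *)
From mathcomp Require Import all_boot.

Set Implicit Arguments.
Unset Strict Implicit.
Unset Printing Implicit Defensive.

(* A family of binary operations on L is a map op : I -> L -> L -> L. *)

(* Planar rooted binary trees with k leaves whose internal vertices are
   labelled by (indices of) operations; the leaves are left unlabelled. *)
Inductive optree (I : Type) : nat -> Type :=
| Leaf : optree I 1
| Node (i : I) (k1 k2 : nat) (T1 : optree I k1) (T2 : optree I k2) :
    optree I (k1 + k2).

Arguments Leaf {I}.

(* T_O(y_1, ..., y_k), where y_c is the label of the c-th leaf from the left;
   positions are counted from 0. *)
Fixpoint eval (I L : Type) (op : I -> L -> L -> L) (k : nat) (T : optree I k) :
    ('I_k -> L) -> L :=
  match T in optree _ k return ('I_k -> L) -> L with
  | Leaf => fun y => y ord0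
  | @Node _ i k1 k2 T1 T2 => fun y =>
      op i (eval op T1 (fun c => y (lshift k2 c)))
           (eval op T2 (fun c => y (rshift k1 c)))
  end.

Definition submagma (I L : Type) (op : I -> L -> L -> L) (k : nat)
    (y : 'I_k -> L) (x : L) : Prop :=
  exists (l : nat) (T : optree I l) (r : 'I_l -> L),
    (forall c, exists d, r c = y d) /\ x = eval op T r.

(* a_k *_{i_k} (a_{k-1} *_{i_{k-1}} ... (a_1 *_{i_1} y) ...);
   enum 'I_k is increasing, so the element of index 0 is multiplied first. *)
Definition iter_lmul (I L : Type) (op : I -> L -> L -> L) (k : nat)
    (i : 'I_k -> I) (a : 'I_k -> L) (y : L) : L :=
  foldl (fun z j => op (i j) (a j) z) y (enum 'I_k).

(* Main.v *)
Require Import Defs.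
From mathcomp Require Import all_boot.

(** By the distributive laws, left multiplications by one family are
    endomorphisms of the other: [alpha] is an endomorphism of [(L, opB)] and
    [beta] one of [(L, opA)].  Endomorphisms commute with tree evaluation,
    which gives the first two claims; the keys agree because [alpha], pushed
    through the left multiplications of [beta], turns each [b j] into
    [alpha (b j)]. *)

Definition endo {I L : Type} (op : I -> L -> L -> L) (f : L -> L) : Prop :=
  forall i x y, f (op i x y) = op i (f x) (f y).

Lemma endo_eval {I L : Type} (op : I -> L -> L -> L) (f : L -> L) :
  endo op f ->
  forall k (T : optree I k) (y : 'I_k -> L),
    f (eval op T y) = eval op T (fun c => f (y c)).
Proof.
move=> fM k; elim=> [//|i k1 k2 T1 IH1 T2 IH2] y /=.
by rewrite fM IH1 IH2.
Qed.

(** Each application of [fM] moves [f] past one left multiplication, at the cost of applying [f] to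
    its multiplier. *)
Lemma endo_iter_lmul {I L : Type} (op : I -> L -> L -> L) (f : L -> L) :
  endo op f ->
  forall k (i : 'I_k -> I) (a : 'I_k -> L) (y : L),
    f (iter_lmul op i a y) = iter_lmul op i (fun j => f (a j)) (f y).
Proof.
move=> fM k i a y; rewrite /iter_lmul.
(* [foldl] updates its accumulator, so the start [y] must stay general in the induction. *)
by elim: (enum 'I_k) y => [//|j e IH] y /=; rewrite IH fM.
Qed.

(** Endomorphisms are closed under composition. Keeping [op] and [op'] separate lets the lemma serve
    both [alpha] and [beta], with the families swapped. *)
Lemma iter_lmul_endo {I J L : Type}
    (op : I -> L -> L -> L) (op' : J -> L -> L -> L) :
  (forall i x, endo op' (op i x)) ->
  forall k (i : 'I_k -> I) (a : 'I_k -> L), endo op' (iter_lmul op i a).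
Proof.
move=> opM k i a j x y; rewrite /iter_lmul.
by elim: (enum 'I_k) x y => [//|c e IH] x y /=; rewrite opM IH.
Qed.

Theorem mainTheorem2
  (L IA IB : Type) (opA : IA -> L -> L -> L) (opB : IB -> L -> L -> L)
  (IA_nonempty : inhabited IA) (IB_nonempty : inhabited IB)
  (distrAB : forall (i : IA) (j : IB) (x y z : L),
     opA i x (opB j y z) = opB j (opA i x y) (opA i x z))
  (distrBA : forall (i : IA) (j : IB) (x y z : L),
     opB j x (opA i y z) = opA i (opB j x y) (opB j x z))
  (m n : nat) (s : 'I_m -> L) (t : 'I_n -> L)
  (kA kB : nat) (kA_ge1 : 1 <= kA) (kB_ge1 : 1 <= kB)
  (a0 : L) (a0_in : submagma opA s a0)
  (a : 'I_kA -> L) (iA : 'I_kA -> IA)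
  (b : 'I_kB -> L) (b_in : forall j, submagma opB t (b j))
  (iB : 'I_kB -> IB)
  (l : nat) (T : optree IA l) (r : 'I_l -> L)
  (r_in : forall c, exists d, r c = s d)
  (a0E : a0 = eval opA T r)
  (lB : 'I_kB -> nat) (TB : forall j, optree IB (lB j))
  (u : forall j, 'I_(lB j) -> L)
  (u_in : forall j c, exists d, u j c = t d)
  (bE : forall j, b j = eval opB (TB j) (u j)) :
  let alpha := iter_lmul opA iA a in
  let beta := iter_lmul opB iB b in
  let p0 := alpha a0 in
  let KA := alpha (beta a0) in
  let KB := iter_lmul opB iB (fun j => alpha (b j)) p0 in
  [/\ eval opA T (fun c => beta (r c)) = beta a0,
      forall j, eval opB (TB j) (fun c => alpha (u j c)) = alpha (b j)
    & KA = KB].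
Proof.
move=> alpha beta p0 KA KB.
have alphaM : endo opB alpha.
  by apply: iter_lmul_endo => i x j; apply: distrAB.
have betaM : endo opA beta.
  by apply: iter_lmul_endo => j x i; apply: distrBA.
split=> [|j|].
- by rewrite a0E (endo_eval _ _ betaM).
- by rewrite bE (endo_eval _ _ alphaM).
(* Taken with [f := alpha] and start [a0]: the new start [alpha a0] is [p0] by definition. *)
- exact: endo_iter_lmul.
Qed.
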